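(* Let $G$ be a graph with a hole cover $\mathcal C$ satisfying the NC property in $G$. If $K\subseteq V(G)$ is a clique in $\widehat G(\mathcal C)$ but not a clique in $G$, then there is a vertex $u\in K\cap\mathcal C$ such that $K\setminus\{u\}$ is a clique in $G$.
   Context: All graphs are finite and simple. A hole of $G$ is an induced cycle of length at least $4$; $\mathcal H(G)$ is the set of holes of $G$ and $\mathcal H(G,u)$ the set of holes containing $u$. A hole cover of $G$ is a nonempty $X\subseteq V(G)$ meeting every hole. A vertex $u$ satisfies the NC property in $G$ if there are no holes $H\in\mathcal H(G,u)$, $H'\in\mathcal H(G)\setminus\mathcal H(G,u)$ sharing two consecutive edges (two distinct edges with a common end vertex lying on both). A set $\mathcal C$ satisfies the NC property in $G$ if each of its vertices does and every hole contains at most one vertex of $\mathcal C$. Locally chordalizing all holes in $\mathcal H(G,u)$ by $u$ means adding all edges $uw$ with $w\ne u$ lying on some hole in $\mathcal H(G,u)$. For a hole cover $\mathcal C=\{u_1,\dots,u_k\}$ satisfying the NC property in $G$, set $G_0=G$, let $G_i$ be obtained from $G_{i-1}$ by locally chordalizing all holes in $\mathcal H(G_{i-1},u_i)$ by $u_i$, and put $\widehat G(\mathcal C)=G_k$ (this graph is chordal and independent of the ordering of $\mathcal C$). *)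

(* Defs.v *)
(* Graphs: a finite vertex type T : finType with a
   Prop-valued adjacency relation (simple: symmetric, irreflexive). *)
From mathcomp Require Import all_boot.
Set Implicit Arguments. Unset Strict Implicit. Unset Printing Implicit Defensive.

Section Holes.
Variable T : finType.
Implicit Types (adj : T -> T -> Prop) (H C K : {set T}).

Definition induced_cycle_seq adj (s : seq T) : Prop :=
  [/\ uniq s, 4 <= size s &
      forall x y, x \in s -> y \in s ->
        (adj x y <-> (y = next s x \/ x = next s y))].

(* A hole (identified with its vertex set; an induced cycle is determined by it). *)
Definition hole adj H : Prop :=
  exists s, induced_cycle_seq adj s /\ H = [set x in s].

Definition hole_cover adj C : Prop :=
  C != set0 /\ forall H, hole adj H -> exists x, x \in C /\ x \in H.

(* NC property of a vertex u: no hole H through u and hole H' avoiding u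
   share two consecutive edges ab, bc (a <> c).  Since holes are induced,
   an edge of G between two vertices of a hole is an edge of that hole. *)
Definition NC_vertex adj (u : T) : Prop :=
  ~ exists H H' (a b c : T),
      [/\ hole adj H, hole adj H', u \in H & u \notin H'] /\
      [/\ a \in H, b \in H & c \in H] /\ [/\ a \in H', b \in H' & c \in H'] /\
      [/\ a <> c, adj a b & adj b c].

Definition NC_set adj C : Prop :=
  (forall u, u \in C -> NC_vertex adj u) /\
  (forall H, hole adj H -> #|H :&: C| <= 1).

Definition local_chordalize adj (u : T) : T -> T -> Prop :=
  fun x y => adj x y
    \/ (x = u /\ y <> u /\ exists H, [/\ hole adj H, u \in H & y \in H])
    \/ (y = u /\ x <> u /\ exists H, [/\ hole adj H, u \in H & x \in H]).

(* \hat G(C) computed along an ordering s of C: G_0 = G, G_i from G_{i-1}. *)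
Definition hatG adj (s : seq T) : T -> T -> Prop :=
  foldl local_chordalize adj s.

Definition clique adj K : Prop :=
  forall x y, x \in K -> y \in K -> x <> y -> adj x y.

End Holes.

(* Main.v *)
Require Import Defs.
From mathcomp Require Import all_boot zify boolp.
Set Implicit Arguments. Unset Strict Implicit. Unset Printing Implicit Defensive.

Ltac alia :=
  intros;
  repeat match goal with
  | H : ?P |- _ =>
    lazymatch P with
    | is_true (leq _ _) => fail
    | is_true (leq _ _ && _) => fail
    | is_true (leq _ _) -> _ => fail
    | is_true (_ == _) => fail
    | is_true ((_ == _) || _) => fail
    | is_true (~~ (_ == _)) => fail
    | is_true (~~ ((_ == _) || _)) => fail
    | _ = _ => fail
    | _ /\ _ => fail
    | _ => clear H
    end
  end; lia.

(** Everything rests on one way of producing holes: if [a], [b] are nonadjacent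
    neighbours of [v] joined by a path whose vertices other than [a], [b] are not
    neighbours of [v], then a shortest such path closes up to a hole through
    [a], [v], [b].

    If [u] has the NC property, a new hole [u, v1, ..., vk] created by locally
    chordalizing at [u] would put [v2] on an old hole through [u] ([attach]), so
    that [u v2] would be a chord.  Hence chordalizing only destroys holes, and
    every edge of the final graph that is not an edge of [G] joins some [u] of
    [C] to a vertex of a hole of [G] through [u].

    Let now [u w] and [u' w'] be nonadjacent pairs of [K] with [u], [u'] distinct
    in [C].  As no hole contains two vertices of [C], [u u'] is an edge, and
    [w = w'] or [w w'] is an edge.  A common non-neighbour [w] of [u] and [u']
    leads to a hole through both ([no_twin_holes]); otherwise [u u' w w'] is
    itself such a hole. *)

(** * Connections and induced paths inside a vertex predicate *)

Section Graph.
Variables (T : finType) (e : rel T).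
Hypothesis e_sym : symmetric e.
Hypothesis e_irr : irreflexive e.
Implicit Types (u v w x y z : T) (P Q : T -> Prop) (H X : {set T}).

(** Every vertex of the path satisfies [P], except that the trivial path imposes nothing; this is
    why [conn_fst] asks for distinct ends. *)
Inductive conn P : T -> T -> Prop :=
| conn_refl x : conn P x x
| conn_step x y z : e x y -> P x -> P y -> conn P y z -> conn P x z.

Lemma conn_edge P x y : e x y -> P x -> P y -> conn P x y.
Proof. by move=> exy Px Py; apply: (conn_step exy) => //; apply: conn_refl. Qed.

Lemma conn_trans P x y z : conn P x y -> conn P y z -> conn P x z.
Proof. by elim=> // {}x {}y t exy Px Py _ IH /IH; apply: conn_step. Qed.

Lemma conn_sym P x y : conn P x y -> conn P y x.
Proof.
elim=> [{}x|{}x {}y t exy Px Py _ IH]; first exact: conn_refl.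
by apply: (conn_trans IH); apply: conn_edge => //; rewrite e_sym.
Qed.

Lemma conn_mono P Q x y : (forall z, P z -> Q z) -> conn P x y -> conn Q x y.
Proof.
move=> PQ; elim=> [{}x|{}x {}y t exy /PQ Px /PQ Py _ IH]; first exact: conn_refl.
exact: (conn_step exy).
Qed.

Lemma conn_fst P x y : conn P x y -> x <> y -> P x.
Proof. by case. Qed.

Lemma conn_seg P (f : nat -> T) i j :
  (forall l, i <= l < j -> e (f l) (f l.+1)) ->
  (forall l, i <= l <= j -> P (f l)) -> i <= j -> conn P (f i) (f j).
Proof.
elim: j => [|j IH] fe fP.
  by rewrite leqn0 => /eqP->; apply: conn_refl.
rewrite leq_eqVlt => /orP[/eqP->|ij]; first exact: conn_refl.
apply: (@conn_trans _ _ (f j)).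
  by apply: IH => // l lij; [apply: fe | apply: fP]; alia.
by apply: conn_edge; [apply: fe | apply: fP | apply: fP]; alia.
Qed.

(** An induced path is recorded from its head on, so that prolonging it at the front only requires
    tests on the new vertex. *)
Fixpoint ipath x (p : seq T) : bool :=
  if p is y :: p' then
    [&& e x y, x \notin p, all (fun z => ~~ e x z) p' & ipath y p']
  else true.

Lemma ipath_uniq x p : ipath x p -> uniq (x :: p).
Proof.
elim: p x => // y p IH x /= /and4P[_ xp _ /IH /= yp].
by rewrite xp.
Qed.

Lemma ipath_nth x0 x p i j : ipath x p -> i < j <= size p ->
  e (nth x0 (x :: p) i) (nth x0 (x :: p) j) = (j == i.+1).
Proof.
elim: p x i j => [|y p IH] x i j /=; first alia.
case/and4P=> exy xp /allP nx ip.
case: j => [|j]; first by rewrite ltn0.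
case: i => [|i] lij; last by rewrite (IH y) // eqSS.
case: j lij => [|j] lij //=.
by rewrite eqSS; apply/negbTE/nx/mem_nth.
Qed.

(** The path is entered at its last vertex that equals [x] or is adjacent to [x], so [x] has no
    chord to what follows. *)
Lemma ipath_cons x y p : ipath y p ->
  has (fun z => (x == z) || e x z) (y :: p) ->
  exists q, [/\ ipath x q, last x q = last y p & {subset q <= y :: p}].
Proof.
elim: p y => [|z p IH] y ip.
  rewrite /= orbF; case: (eqVneq x y) => [->|xy] /= exy.
    by exists [::].
  by exists [:: y]; split=> //=; rewrite inE xy exy.
have /and4P[_ _ _ izp] := ip.
case hz: (has (fun t => (x == t) || e x t) (z :: p)).
  have [q [iq lq sq]] := IH z izp hz.
  move=> _; exists q; split=> // t /sq tq.
  by rewrite inE tq orbT.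
have {}hz := hasPn (negbT hz).
have nx t : t \in z :: p -> (x != t) /\ ~~ e x t.
  by move=> /hz; rewrite negb_or => /andP.
case/hasP=> t; rewrite inE => /orP[/eqP->|tz]; last first.
  by have [/negbTE-> /negbTE->] := nx _ tz.
case: (eqVneq x y) => [->|xy] /= exy.
  by exists (z :: p); split=> // a az; rewrite in_cons az orbT.
exists (y :: z :: p); split=> //.
apply/and4P; split=> //.
  rewrite in_cons negb_or xy; apply/negP => xz.
  by have [] := nx _ xz; rewrite eqxx.
by apply/allP => a /nx[].
Qed.

Lemma conn_ipath P x y : conn P x y ->
  exists q, [/\ ipath x q, last x q = y & forall z, z \in q -> P z].
Proof.
elim=> [{}x|{}x {}y t exy Px Py _ [q [iq lq sq]]]; first by exists [::].
have [|q' [iq' lq' sq']] := @ipath_cons x y q iq; first by rewrite /= exy orbT.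
exists q'; split=> //; first by rewrite lq'.
by move=> z /sq'; rewrite inE => /orP[/eqP->|/sq].
Qed.

(** * Holes listed from a vertex, and holes closed up through a centre *)

(** A hole listed from one of its vertices [v]: the remaining vertices form the
    induced path [f 0, ..., f n.-1]; values of [f] beyond [n] are irrelevant. *)
Record hole_at v n (f : nat -> T) X : Prop := HoleAt {
  hole_at_size : 2 < n;
  hole_at_inj : forall i j, i < n -> j < n -> f i = f j -> i = j;
  hole_at_neq : forall i, i < n -> f i <> v;
  hole_at_center : forall i, i < n -> e v (f i) = (i == 0) || (i.+1 == n);
  hole_at_edge : forall i j, i < n -> j < n ->
    e (f i) (f j) = (j == i.+1) || (i == j.+1);
  hole_at_mem : forall x, x \in X <-> x = v \/ exists2 i, i < n & x = f i }.

Notation ehole := (hole (fun x y => is_true (e x y))).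

(** The default [v] of [nth] carries the wrap-around: for the last [i] the right side is out of
    range and returns [v], the head of the cycle. *)
Lemma next_cons_nth v (s : seq T) i : uniq (v :: s) -> i < size s ->
  next (v :: s) (nth v s i) = nth v s i.+1.
Proof.
move=> us lis; rewrite next_nth.
have -> : nth v s i \in v :: s by rewrite inE mem_nth ?orbT.
have us' : uniq s by case/andP: us.
rewrite [index _ _]/= ifN; last first.
  by case/andP: us => vs _; apply: contra vs => /eqP->; apply: mem_nth.
by rewrite index_uniq.
Qed.

Lemma next_cons_head v (s : seq T) : next (v :: s) v = nth v s 0.
Proof. by rewrite next_nth mem_head /= eqxx. Qed.

Lemma hole_of_hole_at v n f X : hole_at v n f X -> ehole X.
Proof.
case=> n3 finj fv ev ef mX.
set s := mkseq f n.
have ss : size s = n by rewrite size_mkseq.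
have sE i : i < n -> nth v s i = f i by move=> lin; rewrite nth_mkseq.
have sn : nth v s n = v by rewrite nth_default ?ss.
have us : uniq (v :: s).
  rewrite cons_uniq; apply/andP; split; last first.
    by apply/mkseq_uniqP => i j; rewrite !inE; apply: finj.
  by apply/negP => /mapP[i]; rewrite mem_iota => /andP[_ lin] /esym; apply: fv.
exists (v :: s); split; last first.
  apply/setP => x; rewrite !inE; apply/idP/idP.
    move/mX => [->|[i lin ->]]; first by rewrite eqxx.
    by rewrite -sE // mem_nth ?orbT ?ss.
  move=> /orP[/eqP->|/(nthP v)[i]]; rewrite ?ss; first by apply/mX; left.
  by move=> lin <-; apply/mX; right; exists i => //; rewrite sE.
have nf i : i < n -> next (v :: s) (f i) = nth v s i.+1.
  by move=> lin; rewrite -(sE i) // next_cons_nth ?ss.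
have n0 : 0 < n by alia.
have nv : next (v :: s) v = f 0 by rewrite next_cons_head sE.
(* Successors are compared by index; the successor of the last vertex is the default [v], which is
   no [f i]. *)
have fvn i j : i < n -> j < n -> (f i = nth v s j.+1) <-> i = j.+1.
  move=> lin ljn; split; last by move=> eij; rewrite sE ?eij // -eij.
  case: (ltnP j.+1 n) => [ljn'|]; first by rewrite sE //; apply: finj.
  by move=> h; rewrite nth_default ?ss // => /(fv _ lin).
have vvn j : j < n -> (v = nth v s j.+1) <-> j.+1 = n.
  move=> ljn; split; last by move=> ->; rewrite sn.
  case: (ltnP j.+1 n) => [ljn'|]; last by alia.
  by rewrite sE // => /esym /(fv _ ljn').
have ffi i j : i < n -> j < n -> (f i = f j) <-> i = j.
  by move=> lin ljn; split; [apply: finj | move=> ->].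
split; [exact: us | by rewrite [size _]/= ss |].
have memP x : x \in v :: s -> x = v \/ exists2 i, i < n & x = f i.
  rewrite inE => /orP[/eqP->|/(nthP v)[i]]; first by left.
  by rewrite ss => lin <-; right; exists i; rewrite ?sE.
move=> x y /memP[->|[i lin ->]] /memP[->|[j ljn ->]].
- by rewrite e_irr nv; split=> // -[] /esym /(fv _ n0).
- rewrite ev // nv nf //.
  split; first by case/orP=> /eqP h; [left; rewrite h | right; apply/vvn].
  by move=> [/ffi|/vvn] h; apply/orP; [left|right]; apply/eqP; apply: h.
- rewrite e_sym ev // nv nf //.
  split; first by case/orP=> /eqP h; [right; rewrite h | left; apply/vvn].
  by move=> [/vvn|/ffi] h; apply/orP; [right|left]; apply/eqP; apply: h.
- rewrite ef // !nf //.
  split; first by case/orP=> /eqP h; [left | right]; apply/fvn.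
  by move=> [/fvn|/fvn] h; apply/orP; [left|right]; apply/eqP; apply: h.
Qed.

Lemma hole_hole_at v X : ehole X -> v \in X -> exists n f, hole_at v n f X.
Proof.
case=> s0 [[us0 s4 adjs] ->]; rewrite inE => vs0.
have [i s rs] := rot_to vs0.
have us : uniq (v :: s) by rewrite -rs rot_uniq.
have ms x : x \in s0 = (x \in v :: s) by rewrite -rs mem_rot.
have ns x : next s0 x = next (v :: s) x by rewrite -rs next_rot.
have ss : 2 < size s by move: s4; rewrite -(size_rot i) rs.
have us' : uniq s by case/andP: us.
have vs : v \notin s by case/andP: us.
have nm j : j < size s -> nth v s j \in s by apply: mem_nth.
have nv j : j < size s -> nth v s j <> v.
  by move=> lj h; move: vs; rewrite -h nm.
have ninj j k : j < size s -> k < size s -> nth v s j = nth v s k -> j = k.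
  by move=> lj lk /eqP; rewrite nth_uniq // => /eqP.
have vvn j : j < size s -> v = nth v s j.+1 -> j.+1 = size s.
  move=> lj; case: (ltnP j.+1 (size s)) => [lj'|]; last by alia.
  by move=> /esym /(nv _ lj').
have fvn j k : j < size s -> k < size s -> nth v s k = nth v s j.+1 -> k = j.+1.
  move=> lj lk; case: (ltnP j.+1 (size s)) => [lj'|h]; first exact: ninj.
  by rewrite [RHS]nth_default // => /(nv _ lk).
exists (size s), (nth v s); split=> //.
- move=> j lj; have [||h1 h2] := adjs v (nth v s j).
  + by rewrite ms mem_head.
  + by rewrite ms inE nm ?orbT.
  rewrite !ns next_cons_head next_cons_nth // in h1 h2.
  apply/idP/orP => [/h1[h|/(vvn _ lj) ->]|]; last 1 first.
  + case=> /eqP h; apply: h2; first by left; rewrite h.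
    by right; rewrite h nth_default.
  + by left; apply/eqP/ninj => //; alia.
  + by right.
- move=> j k lj lk; have [||h1 h2] := adjs (nth v s j) (nth v s k).
  + by rewrite ms inE nm ?orbT.
  + by rewrite ms inE nm ?orbT.
  rewrite !ns !next_cons_nth // in h1 h2.
  apply/idP/orP => [/h1[/fvn h|/fvn h]|].
  + by left; rewrite h.
  + by right; rewrite h.
  by case=> /eqP h; apply: h2; [left|right]; rewrite -h.
- move=> x; rewrite inE ms inE; split.
    case/orP=> [/eqP|/(nthP v)[j lj <-]]; first by left.
    by right; exists j.
  by case=> [->|[j lj ->]]; rewrite ?eqxx ?nm ?orbT.
Qed.

(** Reversal turns a statement about the neighbour [f 0] of [v], proved for every listing, into one
    about the other neighbour [f n.-1]. *)
Lemma hole_at_rev v n f X :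
  hole_at v n f X -> hole_at v n (fun i => f (n.-1 - i)) X.
Proof.
case=> n3 finj fv ev ef mX; split=> //.
- by move=> i j li lj /finj h; have := h _ _; alia.
- by move=> i li; apply: fv; alia.
- by move=> i li; rewrite ev; alia.
- by move=> i j li lj; rewrite ef; alia.
- move=> x; rewrite mX; split=> -[->|[i li ->]]; auto; right.
    by exists (n.-1 - i); [alia | congr f; alia].
  by exists (n.-1 - i); [alia |].
Qed.

Lemma hole_other_nbr X x y : ehole X -> x \in X ->
  exists z, [/\ z \in X, e x z & z <> y].
Proof.
move=> hX xX; have [n [f [n3 finj fv ev ef mX]]] := hole_hole_at hX xX.
case: (eqVneq (f 0) y) => [<-|/eqP ny].
  exists (f n.-1); split; first by apply/mX; right; exists n.-1 => //; alia.
    by rewrite ev; alia.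
  by move=> /finj h; have := h _ _; alia.
exists (f 0); split=> //; first by apply/mX; right; exists 0 => //; alia.
by rewrite ev; alia.
Qed.

(** An induced path from [a] to [b] inside [P] closes up through [v], which sees only its ends;
    nonadjacency of [a] and [b] forces an inner vertex, hence length at least 4. The last clause
    tells callers which vertices the hole avoids. *)
Lemma hole_centered v a b P : conn P a b -> e v a -> e v b -> a <> b ->
  ~~ e a b -> ~ P v -> (forall x, P x -> e v x -> x = a \/ x = b) ->
  exists X, [/\ ehole X, v \in X, a \in X, b \in X &
    forall x, x \in X -> x = v \/ P x].
Proof.
move=> cab eva evb nab neab nPv onlyab.
have Pa := conn_fst cab nab.
have [p [ip lp pP]] := conn_ipath cab.
have up := ipath_uniq ip.
have aP x : x \in a :: p -> P x by rewrite inE => /orP[/eqP->|/pP].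
set n := size (a :: p); set f := nth v (a :: p).
have fm i : i < n -> f i \in a :: p by apply: mem_nth.
have fl : f n.-1 = b by rewrite /f nth_last.
have hat : hole_at v n f [set x in v :: a :: p].
  split.
  - rewrite /n /=; case: (p) lp ip => [/nab//|y [|//]] /= -> /andP[h].
    by rewrite h in neab.
  - by move=> i j li lj /eqP; rewrite nth_uniq // => /eqP.
  - by move=> i /fm /aP h fv; apply: nPv; rewrite -fv.
  - move=> i li; apply/idP/orP => [evf|].
      have [h|h] := onlyab _ (aP _ (fm _ li)) evf.
        left; move: h => /eqP; rewrite -[X in _ == X]/(f 0) nth_uniq //.
      by right; move: h => /eqP; rewrite -fl nth_uniq //; rewrite /n; alia.
    by case=> /eqP h; [rewrite h | move: evb; rewrite -fl -h].
  - move=> i j; rewrite /n /= !ltnS => li lj; case: (ltngtP i j) => [ij|ij|->].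
    + by rewrite (ipath_nth _ ip); alia.
    + by rewrite e_sym (ipath_nth _ ip); alia.
    + by rewrite e_irr; alia.
  - move=> x; rewrite !inE; split.
      case/orP=> [/eqP|]; first by left.
      rewrite -in_cons => /(nthP v)[j lj <-]; by right; exists j.
    by case=> [->|[j /fm]]; rewrite ?eqxx // inE => h ->; rewrite h orbT.
exists [set x in v :: a :: p]; split; rewrite ?inE ?eqxx ?orbT //.
- exact: hole_of_hole_at hat.
- by rewrite -in_cons -lp mem_last orbT.
by move=> x; rewrite inE in_cons => /orP[/eqP|/aP]; auto.
Qed.

(** * The NC property applied to two holes *)

Lemma NC_vertex_mem u H X a b c :
  NC_vertex (fun x y => is_true (e x y)) u -> ehole H -> ehole X -> u \in H ->
  [/\ a \in H, b \in H & c \in H] -> [/\ a \in X, b \in X & c \in X] ->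
  a <> c -> e a b -> e b c -> u \in X.
Proof.
move=> nc hH hX uH mH mX nac ab bc; apply: contraT => uX; case: nc.
by exists H, X, a, b, c.
Qed.

Definition eNC := NC_vertex (fun x y => is_true (e x y)).

(** If [t] had neighbours on both arcs of [H] between [z] and [u], there would be a
    hole through [t] and both [H]-neighbours of [z] avoiding [u]. *)
Lemma pole_path u z t H : eNC u -> ehole H -> u \in H -> z \in H ->
  z <> u -> ~~ e z u -> t <> z -> t <> u -> ~~ e t z ->
  exists P, [/\ conn P z u, ~ P t & forall x, P x -> e t x -> x = u].
Proof.
move=> nc hH uH zH zu nzu tz tu ntz.
have [n [f hat]] := hole_hole_at hH zH.
have [n3 finj fv ev ef mH] := hat.
have [//|[k kn uE]] := (mH u).1 uH; first by move/esym/zu.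
rewrite uE ev // negb_or in nzu; case/andP: nzu => k0 k1.
have fe i : i.+1 < n -> e (f i) (f i.+1) by move=> li; rewrite ef ?eqxx //; alia.
have inH i : i < n -> f i \in H by move=> li; apply/mH; right; exists i.
(* The index [k] of [u] separates the two arcs of [H] from [z] to [u]. An arc on which [t] has no
   neighbour before [u] is the required path. *)
case: (pselect (exists2 i, i < k & e t (f i))) => [[i ik eti]|noL]; last first.
  exists (fun x => x = z \/ exists2 i, i <= k & x = f i); split.
  - apply: (@conn_step _ _ (f 0)); first by rewrite ev //; alia.
    + by left.
    + by right; exists 0.
    + rewrite uE; apply: conn_seg => // l lk; first by apply: fe; alia.
      by right; exists l => //; alia.
  - move=> [//|[i ik tE]]; case: (eqVneq i k) => [ik'|ik'].
      by apply: tu; rewrite tE ik' -uE.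
    case: i ik tE ik' => [|i] ik tE ik'.
      by move: ntz; rewrite tE e_sym ev //; alia.
    by apply: noL; exists i; [alia | rewrite tE e_sym fe //; alia].
  - move=> x [->|[i ik ->]] etx; first by rewrite etx in ntz.
    case: (eqVneq i k) => [->|ik']; first by rewrite uE.
    by case: noL; exists i => //; alia.
case: (pselect (exists2 j, k < j < n & e t (f j))) => [[j kj etj]|noR]; last first.
  exists (fun x => x = z \/ exists2 i, k <= i < n & x = f i); split.
  - apply: (@conn_step _ _ (f n.-1)); first by rewrite ev //; alia.
    + by left.
    + by right; exists n.-1 => //; alia.
    + rewrite uE; apply: conn_sym; apply: conn_seg => [l lk|l lk|].
      * by apply: fe; alia.
      * by right; exists l => //; alia.
      * by alia.
  - move=> [//|[l lk tE]]; case: (eqVneq l k) => [ik'|ik'].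
      by apply: tu; rewrite tE ik' -uE.
    case: (eqVneq l.+1 n) => [ln|ln].
      by move: ntz; rewrite tE e_sym ev ?ln ?eqxx ?orbT //; alia.
    by apply: noR; exists l.+1; [alia | rewrite tE fe //; alia].
  - move=> x [->|[l lk ->]] etx; first by rewrite etx in ntz.
    case: (eqVneq l k) => [->|ik']; first by rewrite uE.
    by case: noR; exists l => //; alia.
(* A vertex of [H] other than [z] with neighbours on both sides of index [k] can only be [f k],
   which is [u]; hence [t] is not on [H]. *)
have tf l : l < n -> t <> f l.
  move=> ln tE; move: eti etj; rewrite tE !ef; try alia.
  case: (eqVneq l k) => [lk|lk]; last alia.
  by case: tu; rewrite tE lk uE.
set P := fun x => x = t \/ exists2 l, (l < n) && (l != k) & x = f l.
have Pf l : l < n -> l != k -> P (f l).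
  by move=> ln lk; right; exists l; rewrite ?ln.
have [|||||||X [hX zX aX bX XP]] := @hole_centered z (f 0) (f n.-1) P.
- apply: (@conn_trans _ _ (f i)).
    by apply: conn_seg => // l lk; [apply: fe | apply: Pf]; alia.
  apply: (@conn_step _ _ t); [by rewrite e_sym | by apply: Pf; alia | by left |].
  apply: (@conn_step _ _ (f j)); [by [] | by left | by apply: Pf; alia |].
  by apply: conn_seg => [l lk|l lk|]; [apply: fe | apply: Pf |]; alia.
- by rewrite ev; alia.
- by rewrite ev; alia.
- by move=> /finj h; have := h _ _; alia.
- by rewrite ef; alia.
- by move=> [/esym//|[l /andP[ln _] /esym]]; apply: fv.
- move=> x [->|[l /andP[ln lk] ->]]; first by rewrite e_sym (negbTE ntz).
  by rewrite ev // => /orP[/eqP->|/eqP <-]; auto.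
have uX : u \in X.
  apply: (NC_vertex_mem (a := f 0) (b := z) (c := f n.-1) nc hH hX) => //.
  - by split=> //; apply: inH; alia.
  - by move=> /finj h; have := h _ _; alia.
  - by rewrite e_sym ev; alia.
  - by rewrite ev; alia.
have [/esym//|[/esym//|[l /andP[ln lk]]]] := XP _ uX.
by rewrite uE => /finj h; have := h _ _; alia.
Qed.

(** [pole_path] in [H'] links [w] to [u'] with [u'] as the only neighbour of [u]. This forces both
    [H]-neighbours of [u] to be adjacent to [u']. Then [u'] can replace [u] on [H], and a hole
    centred at [w] avoids [u] while sharing two consecutive edges with [H]. *)
Lemma no_twin_holes u u' w H H' : eNC u -> eNC u' ->
  (forall X, ehole X -> u \in X -> u' \in X -> False) ->
  ehole H -> ehole H' -> u \in H -> w \in H -> u' \in H' -> w \in H' ->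
  e u u' -> ~~ e u w -> ~~ e u' w -> w <> u -> w <> u' -> False.
Proof.
move=> ncu ncu' nocom hH hH' uH wH u'H' wH' euu' nuw nu'w wu wu'.
have uu' : u <> u' by move=> h; rewrite h e_irr in euu'.
have nu'H : u' \notin H by apply/negP => /(nocom _ hH uH).
have [|P [cP nPu Pu]] := pole_path ncu' hH' u'H' wH' wu' _ (nesym wu) uu' nuw.
  by rewrite e_sym.
(* Otherwise [u], [u'], the link to [w] and the arc of [H] from [w] back to [f 0] would give a hole
   through both [u] and [u']. *)
have far n f : hole_at u n f H -> e u' (f 0).
  case=> n3 finj fv ev ef mH; apply: contraT => nu'f.
  have [/wu//|[k kn wE]] := (mH w).1 wH.
  rewrite wE ev // negb_or in nuw; case/andP: nuw => k0 k1.
  have u'f i : i < n -> u' <> f i.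
    by move=> li h; move: nu'H; rewrite h => /negP[]; apply/mH; right; exists i.
  pose Q x := P x \/ exists2 l, l <= k & x = f l.
  have [|||||||X [hX uX aX bX XP]] := @hole_centered u u' (f 0) Q.
  - apply: (@conn_trans _ _ w).
      by apply: conn_sym; apply: conn_mono cP => x; left.
    rewrite wE; apply: conn_sym; apply: conn_seg => // l lk.
      by rewrite ef ?eqxx //; alia.
    by right; exists l => //; alia.
  - by [].
  - by rewrite ev //; alia.
  - by apply: u'f; alia.
  - by [].
  - by move=> [//|[l lk /esym]]; apply: fv; alia.
  - move=> x [Px /(Pu _ Px)|[l lk ->]]; first by left.
    by rewrite ev; [case/orP=> /eqP h; [right; rewrite h | alia] | alia].
  by case: (nocom _ hX uX aX).
have [n [f hat]] := hole_hole_at hH uH.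
have e0 := far _ _ hat; have en := far _ _ (hole_at_rev hat).
have [n3 finj fv ev ef mH] := hat.
rewrite subn0 in en.
have fe i : i.+1 < n -> e (f i) (f i.+1) by move=> li; rewrite ef ?eqxx //; alia.
have inH i : i < n -> f i \in H by move=> li; apply/mH; right; exists i.
have [/wu//|[k kn wE]] := (mH w).1 wH.
rewrite wE ev // negb_or in nuw; case/andP: nuw => k0 k1.
set P' := fun x => x = u' \/ exists2 l, (l < n) && (l != k) & x = f l.
have Pf l : l < n -> l != k -> P' (f l).
  by move=> ln lk; right; exists l; rewrite ?ln.
have [|||||||X [hX wX aX bX XP]] := @hole_centered w (f k.-1) (f k.+1) P'.
- apply: (@conn_trans _ _ (f 0)).
    by apply: conn_sym; apply: conn_seg => // l lk; [apply: fe | apply: Pf]; alia.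
  apply: (@conn_step _ _ u'); [by rewrite e_sym | by apply: Pf; alia | by left |].
  apply: (@conn_step _ _ (f n.-1)); [by [] | by left | by apply: Pf; alia |].
  by apply: conn_sym; apply: conn_seg => [l lk|l lk|]; [apply: fe | apply: Pf |]; alia.
- by rewrite wE ef; alia.
- by rewrite wE ef; alia.
- by move=> /finj h; have := h _ _; alia.
- by rewrite ef; alia.
- move=> [//|[l /andP[ln lk]]]; rewrite wE => /finj h; have := h _ _; alia.
- move=> x [->|[l /andP[ln lk] ->]]; first by rewrite e_sym (negbTE nu'w).
  by rewrite wE ef // => /orP[] /eqP h; [right; rewrite h | left; rewrite h].
have : u \in X.
  apply: (NC_vertex_mem (a := f k.-1) (b := w) (c := f k.+1) ncu hH hX) => //.
  - by split=> //; apply: inH; alia.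
  - by move=> /finj h; have := h _ _; alia.
  - by rewrite wE ef; alia.
  - by rewrite wE ef; alia.
by move=> /XP[/esym//|[//|[l /andP[ln lk] /esym]]]; apply: fv.
Qed.

(** * Forcing a vertex onto a hole through [u] *)

(** An induced path from [w] is followed up to the first vertex [x] with a neighbour in [D], and [Q]
    is the part traversed. Before [x] nothing touches [D], so [Q] cannot enter [D]. *)
Lemma first_contact P (D : T -> Prop) w u : conn P w u -> ~ D w -> D u ->
  exists (Q : T -> Prop) x,
   [/\ Q w, Q x, (forall z, Q z -> z = w \/ P z), (forall z, Q z -> ~ D z) &
        (x = w -> forall z, Q z -> z = w)] /\
   [/\ (forall z, Q z -> conn Q z x),
        (forall z, Q z -> z <> w -> conn (fun y => Q y /\ y <> w) z x),
        (exists2 y, D y & e x y) &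
        (forall z y, Q z -> D y -> e z y -> z = x)].
Proof.
move=> /conn_ipath[p [ip lp pP]] Dw Du.
(* For the induction [Q] is confined to the list [w :: p], whose distinctness keeps [w] off the rest
   of the path. *)
suff [Q [x [[Qw Qx Qp QD Q1] Q2]]] : exists (Q : T -> Prop) x,
   [/\ Q w, Q x, (forall z, Q z -> z \in w :: p), (forall z, Q z -> ~ D z) &
        (x = w -> forall z, Q z -> z = w)] /\
   [/\ (forall z, Q z -> conn Q z x),
        (forall z, Q z -> z <> w -> conn (fun y => Q y /\ y <> w) z x),
        (exists2 y, D y & e x y) &
        (forall z y, Q z -> D y -> e z y -> z = x)].
  exists Q, x; split=> //; split=> // z /Qp.
  by rewrite inE => /orP[/eqP|/pP]; auto.
elim: p w ip lp Dw {pP} => [|y p IH] w ip lp Dw; first by case: Dw; rewrite -lp in Du.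
case: (pselect (exists2 t, D t & e w t)) => [wD|nwD].
  exists (eq^~ w), w; split; split=> //.
  - by move=> z ->; rewrite mem_head.
  - by move=> z ->.
  - by move=> z ->; apply: conn_refl.
have /and4P[ewy wp _ ip'] := ip.
have [|Q [x [[Qy Qx Qp QD Q1] [Qc Qcw xD Qu]]]] := IH y ip' lp.
  by move=> Dy; apply: nwD; exists y.
have Qw z : Q z -> z <> w by move=> /Qp zp zw; rewrite -zw zp in wp.
exists (fun z => z = w \/ Q z), x; split; split=> //; auto.
- by move=> z [->|/Qp zp]; rewrite inE ?eqxx // zp orbT.
- by move=> z [->|/QD].
- by move=> xw; case: (Qw _ Qx).
- have cm z : Q z -> conn (fun z => z = w \/ Q z) z x.
    by move=> /Qc; apply: conn_mono; auto.
  move=> z [->|/cm //]; apply: (conn_step ewy); auto.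
- move=> z [//|Qz] zw; apply: conn_mono (Qc _ Qz) => t Qt.
  by split; [right | apply: Qw].
- move=> z t [->|Qz] Dt ezt; last exact: (Qu z t).
  by case: nwD; exists t.
Qed.

(** [x] is the first vertex on the way from [w] to [u] having a neighbour on [H]
    other than [v] and the two [H]-neighbours of [v].  If [w] is on no hole
    through [u], each of these two can be joined to [x] avoiding [u] and the
    neighbourhood of [v], giving a hole through both, centred at [v], that
    violates the NC property. *)
Lemma attach u v w H P : eNC u -> ehole H -> u \in H -> v \in H ->
  v <> u -> ~~ e v u -> e v w -> ~~ e w u -> conn P w u -> ~ P v ->
  (forall x, P x -> e v x -> x = w) ->
  exists X, [/\ ehole X, u \in X & w \in X].
Proof.
move=> nc hH uH vH vu nvu evw nwu cP nPv Pw.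
apply: contrapT => nX0.
have nX X : ehole X -> u \in X -> w \in X -> False.
  by move=> hX uX wX; apply: nX0; exists X.
(* A hole through [w] sharing two consecutive edges with [H] would contain [u] by the NC property,
   against [nX]. *)
have share X a b c : ehole X -> w \in X ->
    [/\ a \in H, b \in H & c \in H] -> [/\ a \in X, b \in X & c \in X] ->
    a <> c -> e a b -> e b c -> False.
  move=> hX wX mH mX ac ab bc; apply: (nX X) => //.
  exact: NC_vertex_mem nc hH hX uH mH mX ac ab bc.
have wH : w \notin H by apply/negP => wH; apply: (nX H).
have vw : v <> w by move=> h; move: evw; rewrite h e_irr.
pose D x := [/\ x \in H, x <> v & ~~ e v x].
have [||Q [x [[Qw Qx QP QD Q1] [Qc Qcw [y Dy exy] Qu]]]] :=
  @first_contact P D w u cP.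
- by case=> h; rewrite h in wH.
- by split=> //; apply/nesym.
have Qv : ~ Q v by move=> /QP[].
have Qvw z : Q z -> e v z -> z = w by move=> /QP[//|/Pw].
have QH z : Q z -> z \notin H.
  move=> Qz; apply/negP => zH; apply: (QD z Qz); split=> //.
    by move=> h; apply: Qv; rewrite -h.
  by apply/negP => /(Qvw _ Qz) h; rewrite h in zH; rewrite zH in wH.
have Df n f i : hole_at v n f H -> 0 < i -> i.+1 < n -> D (f i).
  case=> n3 finj fv ev ef mH i0 i1; split.
  - by apply/mH; right; exists i => //; alia.
  - by apply: fv; alia.
  - by rewrite ev; alia.
have fD n f z : hole_at v n f H -> D z ->
    exists2 j, 0 < j & j.+1 < n /\ z = f j.
  case=> n3 finj fv ev ef mH [/mH[//|[j jn ->]] _].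
  by rewrite ev // => h; exists j; [|split=> //]; alia.
have fQ n f i : hole_at v n f H -> i < n -> ~ Q (f i).
  case=> n3 finj fv ev ef mH li /QH/negP[].
  by apply/mH; right; exists i.
(* Otherwise the cycle from [v] through [w], [x], [y] and along [H] back to [f 1] gives a hole
   centred at [f 0]. Its other neighbour of [v] is [w], contradicting [share]. *)
have near n f : hole_at v n f H -> exists2 z, Q z & e z (f 0).
  move=> hat; have [n3 finj fv ev ef mH] := hat.
  apply: contrapT => no.
  have [j j0 [jn yE]] := fD _ _ _ hat Dy.
  pose P2 z := [\/ z = v, Q z | exists2 l, 1 <= l <= j & z = f l].
  have [|||||||X [hX cX aX bX XP]] := @hole_centered (f 0) v (f 1) P2.
  - apply: (conn_step evw); [by constructor 1 | by constructor 2 |].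
    apply: (@conn_trans _ _ x).
      by apply: conn_mono (Qc _ Qw) => z; constructor 2.
    apply: (@conn_step _ _ (f j)).
    + by rewrite -yE.
    + by constructor 2.
    + by constructor 3; exists j => //; alia.
    apply: conn_sym; apply: conn_seg => // l lj; first by rewrite ef; alia.
    by constructor 3; exists l.
  - by rewrite e_sym ev; alia.
  - by rewrite ef; alia.
  - by move/esym; apply: fv; alia.
  - by rewrite ev; alia.
  - case=> [|/(fQ _ _ _ hat)|[l lj /finj h]]; first by apply: fv; alia.
      by apply; alia.
    by have := h _ _; alia.
  - move=> z [->|Qz|[l lj ->]]; first by left.
      by rewrite e_sym => h; case: no; exists z.
    by rewrite ef; try alia; move=> h; right; congr f; alia.
  have [z [zX evz zf]] := hole_other_nbr (f 0) hX aX.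
  have wX : w \in X.
    case: (XP _ zX) => [//|[h|Qz|[l lj h]]].
    - by rewrite h e_irr in evz.
    - by rewrite -(Qvw _ Qz).
    - by move: evz; rewrite h ev; alia.
  apply: (share X v (f 0) (f 1)) => //.
  - by split=> //; apply/mH; right; [exists 0 | exists 1] => //; alia.
  - by move/esym; apply: fv; alia.
  - by rewrite ev; alia.
  - by rewrite ef; alia.
have [n [f hat]] := hole_hole_at hH vH.
have [n3 finj fv ev ef mH] := hat.
have hat' := hole_at_rev hat.
have [/esym//|[k kn uE]] := (mH u).1 uH.
have k01 : 0 < k /\ k.+1 < n by move: nvu; rewrite uE ev //; alia.
have fe i : i.+1 < n -> e (f i) (f i.+1) by move=> li; rewrite ef ?eqxx //; alia.
(* If [x = w] then [Q] is just [w], so by [near] [w] is adjacent to both [H]-neighbours of [v] and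
   can replace [v] on [H]. The hole centred at [u] then avoids [w], hence lies in [H] without [v],
   which is a path. *)
case: (eqVneq x w) => [xw|/eqP xw].
  have [z /(Q1 xw) -> ew0] := near _ _ hat.
  have [{}z /(Q1 xw) ->] := near _ _ hat'; rewrite subn0 => ewn.
  pose P2 z := z = w \/ exists2 l, (l < n) && (l != k) & z = f l.
  have Pf l : l < n -> l != k -> P2 (f l).
    by move=> ln lk; right; exists l; rewrite ?ln.
  have [|||||||X [hX uX aX bX XP]] := @hole_centered u (f k.-1) (f k.+1) P2.
  - apply: (@conn_trans _ _ (f 0)).
      apply: conn_sym; apply: conn_seg => // l lk; [apply: fe | apply: Pf]; alia.
    apply: (@conn_step _ _ w); [by rewrite e_sym | by apply: Pf; alia | by left |].
    apply: (@conn_step _ _ (f n.-1)); [by [] | by left | by apply: Pf; alia |].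
    by apply: conn_sym; apply: conn_seg => [l lk|l lk|]; [apply: fe | apply: Pf |]; alia.
  - by rewrite uE ef; alia.
  - by rewrite uE ef; alia.
  - by move=> /finj h; have := h _ _; alia.
  - by rewrite ef; alia.
  - case=> [h|[l /andP[ln lk]]]; first by rewrite h in uH; rewrite uH in wH.
    by rewrite uE => /finj h; have := h _ _; alia.
  - move=> z' [->|[l /andP[ln lk] ->]]; first by rewrite e_sym (negbTE nwu).
    by rewrite uE ef // => /orP[] /eqP h; [right; rewrite h | left; rewrite h].
  have wX : w \notin X by apply/negP => /(nX _ hX uX).
  have Xf t : t \in X -> exists2 l, l < n & t = f l.
    move=> tX; case: (XP _ tX) => [->|[tw|[l /andP[ln _] ->]]].
    - by exists k.
    - by rewrite tw in tX; rewrite tX in wX.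
    - by exists l.
  (* The vertex of [X] of least index would have at most one neighbour in [X]. *)
  have exX : exists l, (l < n) && (f l \in X) by exists k; rewrite kn -uE.
  case: (ex_minnP exX) => m /andP[mn mX] mmin.
  have [t [tX et tm]] := hole_other_nbr (f m.+1) hX mX.
  have [l ln tE] := Xf _ tX.
  have ml : m <= l by apply: mmin; rewrite ln -tE.
  move: et; rewrite tE ef // => h; apply: tm; rewrite tE; congr f; alia.
(* The claim is stated for an arbitrary listing, so that it serves for both [H]-neighbours of
   [v]. *)
have side n' f' : hole_at v n' f' H ->
    conn (fun z => (Q z /\ z <> w) \/ [/\ z \in H, z <> u & z <> v]) (f' 0) x.
  move=> {n f n3 finj fv ev ef mH hat hat' k kn uE k01 fe}.
  set R := (fun z => _ \/ _) => hat; move: n' f' hat => n f hat.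
  have [n3 finj fv ev ef mH] := hat.
  have inH i : i < n -> f i \in H by move=> li; apply/mH; right; exists i.
  have Rf i : i < n -> f i <> u -> R (f i).
    by move=> li fu; right; split; [apply: inH | | apply: fv].
  have f0u : f 0 <> u.
    by move=> h; move: nvu; rewrite -h ev; alia.
  have RQ z : Q z -> z <> w -> conn R z x.
    by move=> Qz zw; apply: conn_mono (Qcw _ Qz zw) => t; left.
  case: (pselect (exists z, [/\ Q z, z <> w & e z (f 0)])) => [[z [Qz zw ez]]|no].
    apply: (@conn_step _ _ z); first by rewrite e_sym.
    + by apply: Rf => //; alia.
    + by left.
    + exact: RQ.
  have only0 z : Q z -> e (f 0) z -> z = w.
    move=> Qz; rewrite e_sym => ez; apply: contrapT => zw.
    by apply: no; exists z.
  have ew0 : e w (f 0).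
    have [z Qz ez] := near _ _ hat.
    by rewrite -(only0 _ Qz) // e_sym.
  have nx0 : ~~ e (f 0) x by apply/negP => /(only0 _ Qx).
  have D1 : D (f 1) by apply: Df hat _ _; alia.
  have wX X : ehole X -> f 0 \in X ->
      (forall z, z \in X -> e (f 0) z -> Q z \/ z = f 1) -> w \in X.
    move=> hX fX XQ; have [z [zX ez zf]] := hole_other_nbr (f 1) hX fX.
    by have [Qz|//] := XQ z zX ez; rewrite -(only0 z).
  (* Otherwise a hole centred at [f 1] passes through [f 0] and [f 2]. As [w] is the only neighbour
     of [f 0] in [Q], the hole contains [w], contradicting [share]. *)
  have ex1 : e x (f 1).
    apply: contraT => nx1.
    have [j j0 [jn yE]] := fD _ _ _ hat Dy.
    have j1 : 1 < j.
      by rewrite ltn_neqAle j0 andbT; apply: contraNneq nx1 => ->; rewrite -yE.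
    pose P2 z := [\/ z = f 0, Q z | exists2 l, 2 <= l <= j & z = f l].
    have [|||||||X [hX cX aX bX XP]] := @hole_centered (f 1) (f 0) (f 2) P2.
    - apply: (@conn_step _ _ w); first by rewrite e_sym.
      + by constructor 1.
      + by constructor 2.
      apply: (@conn_trans _ _ x).
        by apply: conn_mono (Qc _ Qw) => z; constructor 2.
      apply: (@conn_step _ _ (f j)).
      + by rewrite -yE.
      + by constructor 2.
      + by constructor 3; exists j => //; alia.
      apply: conn_sym; apply: conn_seg => // l lj; first by rewrite ef; alia.
      by constructor 3; exists l.
    - by rewrite ef; alia.
    - by rewrite ef; alia.
    - by move=> /finj h; have := h _ _; alia.
    - by rewrite ef; alia.
    - case=> [/finj h|/(fQ _ _ _ hat)|[l lj /finj h]]; first by have := h _ _; alia.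
        by apply; alia.
      by have := h _ _; alia.
    - move=> z [->|Qz|[l lj ->]]; first by left.
        by rewrite e_sym => ez; move: nx1; rewrite -(Qu _ _ Qz D1 ez) ez.
      by rewrite ef; try alia; move=> h; right; congr f; alia.
    have {}wX : w \in X.
      apply: wX hX aX _ => z /XP[->|[->|Qz|[l lj ->]]]; auto.
        by rewrite e_irr.
      by rewrite ef; alia.
    exfalso; apply: (share X (f 0) (f 1) (f 2)) => //.
    - by split; apply: inH; alia.
    - by move=> /finj h; have := h _ _; alia.
    - by rewrite ef; alia.
    - by rewrite ef; alia.
  case: (eqVneq (f 1) u) => [f1u|/eqP f1u]; last first.
    apply: (@conn_step _ _ (f 1)); first by rewrite ef; alia.
    + by apply: Rf => //; alia.
    + by apply: Rf => //; alia.
    apply: conn_edge; first by rewrite e_sym.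
    + by apply: Rf => //; alia.
    + by left.
  (* Here [f 1] is [u], and closing the path from [f 0] through [w] to [x] at [f 1] puts [u] and [w]
     on one hole. *)
  pose P2 z := z = f 0 \/ Q z.
  have [|||||||X [hX cX aX bX XP]] := @hole_centered (f 1) (f 0) x P2.
  - apply: (@conn_step _ _ w); [by rewrite e_sym | by left | by right |].
    by apply: conn_mono (Qc _ Qw) => z; right.
  - by rewrite ef; alia.
  - by rewrite e_sym.
  - by move=> h; apply: (fQ _ _ 0 hat); [alia | rewrite h].
  - by [].
  - case=> [/finj h|/(fQ _ _ _ hat) h]; first by have := h _ _; alia.
    by apply: h; alia.
  - move=> z [->|Qz]; first by left.
    by rewrite e_sym => /(Qu _ _ Qz D1); right.
  exfalso; apply: (nX X) => //; first by rewrite -f1u.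
  by apply: wX hX aX _ => z /XP[->|[->|Qz]]; auto; rewrite e_irr.
have c1 := side _ _ hat; have c2 := side _ _ hat'; rewrite subn0 in c2.
have [||||||X [hX cX aX bX XP]] := hole_centered (v := v) (conn_trans c1 (conn_sym c2)).
- by rewrite ev; alia.
- by rewrite ev; alia.
- by move=> /finj h; have := h _ _; alia.
- by rewrite ef; alia.
- by case=> [[]//|[]].
- move=> z [[Qz zw] /(Qvw _ Qz)//|[/mH[//|[l ln ->]] _ _]].
  by rewrite ev // => /orP[/eqP->|/eqP <-]; auto.
have : u \in X.
  apply: (NC_vertex_mem (a := f 0) (b := v) (c := f n.-1) nc hH hX) => //.
  - by split=> //; apply/mH; right; [exists 0 | exists n.-1] => //; alia.
  - by move=> /finj h; have := h _ _; alia.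
  - by rewrite e_sym ev; alia.
  - by rewrite ev; alia.
by case/XP=> [/esym//|[[/QH]|[]//]]; rewrite uH.
Qed.

(** [g] lists the hole created at [u], without [u] itself, and [u (g 0)] is a new edge. Following
    [g] from [g 1] to [g m] and then going to [u], directly or by [pole_path], provides the path
    that [attach] needs with centre [g 0]. *)
Lemma chordal_path_step u (g : nat -> T) m : eNC u -> 1 < m ->
  (forall l, l < m -> e (g l) (g l.+1)) ->
  (forall l, 1 < l <= m -> ~~ e (g 0) (g l)) ->
  (forall l, 0 < l <= m -> g l <> g 0) -> (forall l, l <= m -> g l <> u) ->
  (exists X, [/\ ehole X, u \in X & g 0 \in X]) -> ~~ e u (g 0) ->
  e u (g m) \/ (exists X, [/\ ehole X, u \in X & g m \in X]) ->
  ~~ e u (g 1) -> exists X, [/\ ehole X, u \in X & g 1 \in X].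
Proof.
move=> nc m1 ge gne g0 gu [H [hH uH gH]] nu0 um nu1.
have [P [cP nPg Pg]] : exists P : T -> Prop, [/\ conn P (g m) u, ~ P (g 0) &
    forall x, P x -> e (g 0) x -> x = u].
  case: (boolP (e u (g m))) um => [eum _|neum [//|[H' [hH' uH' gH']]]].
    exists (fun x => x = g m \/ x = u); split.
    - by apply: conn_edge; [rewrite e_sym | left | right].
    - by case=> h; [apply: (g0 m); [alia | rewrite h] | apply: (gu 0)].
    - by move=> x [->|//]; rewrite (negbTE (gne _ _)) //; alia.
  apply: (pole_path nc hH' uH' gH').
  - by apply: gu.
  - by rewrite e_sym.
  - by apply/nesym/g0; alia.
  - by apply: gu.
  - by apply: gne; alia.
pose Q x := P x \/ exists2 l, 0 < l <= m & x = g l.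
apply: (@attach u (g 0) (g 1) H Q) => //.
- exact: gu.
- by rewrite e_sym.
- by apply: ge; alia.
- by rewrite e_sym.
- apply: (@conn_trans _ _ (g m)); last by apply: conn_mono cP => x; left.
  apply: conn_seg => [l lm|l lm|]; [by apply: ge; alia | by right; exists l | alia].
- by case=> [//|[l lm /esym]]; apply: g0.
move=> x [Px e0x|[l lm ->]].
  by move: nu0; rewrite -(Pg _ Px e0x) e_sym e0x.
by case: (ltnP 1 l) => l1; [rewrite (negbTE (gne _ _)) //; alia | move=> _; congr g; alia].
Qed.

End Graph.

(** The equality of relations lets [rewrite] carry holes and the NC property over to the boolean
    setting of the previous section. *)
Lemma relation_asbool (T : Type) (adj : T -> T -> Prop) :
  exists e : rel T, adj = (fun x y => is_true (e x y)).
Proof.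
exists (fun x y => `[< adj x y >]).
by apply/funext => x; apply/funext => y; rewrite asboolE.
Qed.

(** * Effect of local chordalization on holes, the NC property and edges *)

Section LocalChordalization.
Variable T : finType.
Implicit Types (adj : T -> T -> Prop) (u x y : T) (X H : {set T}).

Lemma eq_in_hole adj adj' X :
  (forall x y, x \in X -> y \in X -> adj x y <-> adj' x y) ->
  hole adj X -> hole adj' X.
Proof.
move=> eqadj [s [[us s4 adjs] XE]]; exists s; split=> //; split=> // x y xs ys.
by rewrite -adjs //; apply: iff_sym; apply: eqadj; rewrite XE inE.
Qed.

Lemma local_chordalize_sym adj u : (forall x y, adj x y -> adj y x) ->
  forall x y, local_chordalize adj u x y -> local_chordalize adj u y x.
Proof. by move=> sym x y [/sym|[|]]; rewrite /local_chordalize; tauto. Qed.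

Lemma local_chordalize_irr adj u : (forall x, ~ adj x x) ->
  forall x, ~ local_chordalize adj u x x.
Proof. by move=> irr x [/irr|[[-> []]|[-> []]]]. Qed.

Lemma local_chordalize_off adj u x y : x <> u -> y <> u ->
  local_chordalize adj u x y -> adj x y.
Proof. by move=> xu yu [|[[]|[]]]. Qed.

(** Off [u] adjacency is unchanged. A hole through [u] would acquire the chord from [u] to [f 1],
    whether or not it uses a new edge at [u]. *)
Lemma hole_local_chordalize adj u X :
  (forall x y, adj x y -> adj y x) -> (forall x, ~ adj x x) ->
  NC_vertex adj u -> hole (local_chordalize adj u) X -> hole adj X /\ u \notin X.
Proof.
move=> sym0 irr0.
have sym' := @local_chordalize_sym adj u sym0.
have irr' := @local_chordalize_irr adj u irr0.
move=> nc hX; case: (boolP (u \in X)) => [uX|uX]; last first.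
  split=> //; apply: eq_in_hole hX => x y xX yX; split; last by left.
  by apply: local_chordalize_off => h; [move: xX | move: yX]; rewrite h (negbTE uX).
exfalso.
have [e aE] := relation_asbool adj.
have [e' aE'] := relation_asbool (local_chordalize adj u).
have e_sym : symmetric e.
  by move=> x y; move: sym0; rewrite aE => s; apply/idP/idP; apply: s.
have e_irr : irreflexive e.
  by move=> x; move: irr0; rewrite aE => s; apply/negP; apply: s.
have e'P x y : e' x y <-> local_chordalize adj u x y by rewrite aE'.
have e'_off x y : x <> u -> y <> u -> e' x y = e x y.
  move=> xu yu; apply/idP/idP => [/e'P|exy].
    by rewrite aE; apply: local_chordalize_off.
  by apply/e'P; left; rewrite aE.
have onhole x : x <> u -> e' u x <-> e u x \/
    exists H, [/\ hole (fun x y => is_true (e x y)) H, u \in H & x \in H].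
  move=> xu; rewrite e'P /local_chordalize aE.
  split; last by case; tauto.
  by case=> [|[[_ []]|[/xu]]]; tauto.
rewrite aE' in hX; rewrite aE in nc.
(* A new edge from [u] to [f 0] would put [f 1] on an old hole through [u], making [f 1] adjacent to
   [u]. *)
have hat_new n f : hole_at e' u n f X -> e u (f 0).
  case=> n3 finj fv ev ef mX; apply: contraT => nu0.
  have f'E i : i < n -> e' u (f i) <-> e u (f i) \/
      exists H, [/\ hole (fun x y => is_true (e x y)) H, u \in H & f i \in H].
    by move=> li; apply: onhole; apply: fv.
  have nu1 : ~ e' u (f 1) by rewrite ev; alia.
  exfalso; apply: (nu1); apply/f'E; first alia; right.
  have efE i j : i < n -> j < n -> e (f i) (f j) = (j == i.+1) || (i == j.+1).
    by move=> li lj; rewrite -e'_off ?ef //; apply: fv.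
  apply: (@chordal_path_step T e e_sym e_irr u f n.-1) => //.
  - alia.
  - by move=> l lm; rewrite efE; alia.
  - by move=> l lm; rewrite efE; alia.
  - by move=> l lm /finj h; have := h _ _; alia.
  - by move=> l lm; apply: fv; alia.
  - have n0 : 0 < n by alia.
    have: e' u (f 0) by rewrite ev.
    by case/(f'E _ n0) => //; rewrite (negbTE nu0).
  - by apply/f'E; [alia | rewrite ev; alia].
  - by apply/negP => h; apply: nu1; apply/f'E; [alia | left].
have [n [f hat]] := hole_hole_at hX uX.
have e0 := hat_new _ _ hat; have en := hat_new _ _ (hole_at_rev hat).
rewrite subn0 in en.
have [n3 finj fv ev ef mX] := hat.
have onX x : x \in X -> e' u x -> e u x.
  case/mX=> [->|[i li ->]].
    by move/e'P/irr'.
  by rewrite ev // => /orP[] /eqP h; [rewrite h | move: en; rewrite -h].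
(* Both edges of [X] at [u] are now old, so [X] is itself an old hole through [u], and chordalizing
   it adds this chord. *)
have : e' u (f 1).
  apply/onhole; first by apply: fv; alia.
  right; exists X; split=> //; last by apply/mX; right; exists 1 => //; alia.
  apply: eq_in_hole hX => x y xX yX; split; last first.
    by move=> exy; apply/e'P; left; rewrite aE.
  case: (eqVneq x u) => [->|/eqP xu]; first exact: onX.
  case: (eqVneq y u) => [->|/eqP yu]; last by rewrite e'_off.
  by move=> /e'P/sym'/e'P/(onX _ xX); rewrite e_sym.
by rewrite ev; alia.
Qed.

Lemma NC_vertex_local_chordalize adj u v :
  (forall x y, adj x y -> adj y x) -> (forall x, ~ adj x x) ->
  NC_vertex adj u -> NC_vertex adj v -> NC_vertex (local_chordalize adj u) v.
Proof.
move=> sym irr ncu ncv [H [H' [a [b [c [[hH hH' vH vH'] [[aH bH cH] [mH' [ac ab bc]]]]]]]]].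
have [hH1 uH] := hole_local_chordalize sym irr ncu hH.
have [hH'1 _] := hole_local_chordalize sym irr ncu hH'.
have off x : x \in H -> x <> u by move=> xH xu; rewrite -xu xH in uH.
apply: ncv; exists H, H', a, b, c; split=> //; split=> //; split=> //.
by split=> //; apply: (@local_chordalize_off _ u) => //; apply: off.
Qed.

(** The NC property survives each step, and every hole met later is already a hole of [adj]; so each
    added edge has a witness in the original graph. *)
Lemma hatG_edge adj (s : seq T) x y :
  (forall x y, adj x y -> adj y x) -> (forall x, ~ adj x x) ->
  (forall u, u \in s -> NC_vertex adj u) -> hatG adj s x y ->
  adj x y \/ exists H, [/\ hole adj H, x \in H, y \in H & (x \in s) || (y \in s)].
Proof.
elim: s adj => [|u s IH] adj sym irr nc /=; first by left.
have ncu := nc u (mem_head _ _).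
case/(IH _ (local_chordalize_sym sym) (local_chordalize_irr irr)).
- move=> v vs; apply: NC_vertex_local_chordalize => //.
  by apply: nc; rewrite inE vs orbT.
- case=> [|[[-> [_ [H [hH uH yH]]]]|[-> [_ [H [hH uH xH]]]]]]; first by left.
    by right; exists H; rewrite !inE eqxx.
  by right; exists H; rewrite !inE eqxx orbT.
- case=> H [hH xH yH xys]; right; exists H; split=> //.
    by have [] := hole_local_chordalize sym irr ncu hH.
  by rewrite !inE; case/orP: xys => ->; rewrite !orbT.
Qed.

End LocalChordalization.

(** * Cliques of the chordalized graph *)

Theorem theorem2p6 (T : finType) (adj : T -> T -> Prop)
  (adj_sym : forall x y, adj x y -> adj y x)
  (adj_irr : forall x, ~ adj x x)
  (C : {set T}) (HC : hole_cover adj C) (HNC : NC_set adj C)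
  (s : seq T) (s_uniq : uniq s) (s_C : [set x in s] = C)
  (K : {set T}) (HK : clique (hatG adj s) K) (HnK : ~ clique adj K) :
  exists u, u \in K :&: C /\ clique adj (K :\ u).
Proof.
have [ncC oneC] := HNC.
have sC x : (x \in s) = (x \in C) by rewrite -s_C inE.
have oneC2 H x y : hole adj H -> x \in H -> y \in H -> x \in C -> y \in C -> x = y.
  move=> /oneC/card_le1_eqP h xH yH xC yC.
  by apply: h; rewrite inE ?xH ?yH ?xC ?yC.
pose bad x y := [/\ x \in K, y \in K, x <> y & ~ adj x y].
have bad_sym x y : bad x y -> bad y x.
  by case=> xK yK xy nxy; split=> //; [apply/nesym | move/adj_sym].
have badP x y : bad x y ->
    exists H, [/\ hole adj H, x \in H, y \in H & (x \in C) || (y \in C)].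
  case=> xK yK xy nxy.
  have [|//|] := @hatG_edge _ adj s x y adj_sym adj_irr _ (HK _ _ xK yK xy).
    by move=> u; rewrite sC; apply: ncC.
  by case=> H; rewrite !sC; exists H.
have orient x y : bad x y -> exists u w, [/\ u \in C, bad u w &
    (u = x /\ w = y) \/ (u = y /\ w = x)].
  move=> bxy; have [H [_ _ _ /orP[xC|yC]]] := badP _ _ bxy.
    by exists x, y; split; auto.
  by exists y, x; split; auto; apply: bad_sym.
have [x [y bxy]] : exists x y, bad x y.
  apply: contrapT => no; apply: HnK => x y xK yK xy.
  by apply: contrapT => nxy; apply: no; exists x, y.
(* The end in [C] of any nonadjacent pair of [K] serves as [u]; a second such pair avoiding [u] is
   refuted below. *)
have [u [w [uC buw _]]] := orient _ _ bxy.
exists u; split; first by rewrite inE uC andbT; case: buw.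
move=> a b; rewrite !inE => /andP[/eqP au aK] /andP[/eqP bu bK] ab.
apply: contrapT => nab.
have [u' [w' [u'C bu'w' uw'E]]] := orient a b (And4 aK bK ab nab).
have u'u : u' <> u by case: uw'E => -[-> _].
have [e aE] := relation_asbool adj.
have e_sym : symmetric e.
  by move=> p q; move: adj_sym; rewrite aE => h; apply/idP/idP; apply: h.
have e_irr : irreflexive e.
  by move=> p; move: adj_irr; rewrite aE => h; apply/negP; apply: h.
have adjP p q : adj p q <-> e p q by rewrite aE.
have nocom X : hole (fun x y => is_true (e x y)) X -> u \in X -> u' \in X -> False.
  rewrite -aE => hX uX u'X; apply: u'u; exact: oneC2 hX _ _ _ _.
have notC p q : p \in C -> bad p q -> q \notin C.
  move=> pC bpq; have [H [hH pH qH _]] := badP _ _ bpq.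
  by case: bpq => _ _ pq _; apply/negP => qC; apply: pq; apply: oneC2 hH _ _ _ _.
(* A nonadjacent pair of [K] lies on a hole and has exactly one end in [C], since a hole has at most
   one vertex in [C]. *)
have adjK p q : p \in K -> q \in K -> p <> q ->
    (p \in C) = (q \in C) -> adj p q.
  move=> pK qK pq pqC; apply: contrapT => npq.
  have bpq : bad p q by [].
  have [H [_ _ _]] := badP _ _ bpq; rewrite -pqC orbb => pC.
  by have := notC _ _ pC bpq; rewrite -pqC pC.
have same t : bad u t -> bad u' t -> False.
  move=> but bu't.
  have [H [hH uH tH _]] := badP _ _ but; have [H' [hH' uH' tH' _]] := badP _ _ bu't.
  case: but bu't => uK tK ut nut [u'K _ u't nu't].
  rewrite aE in hH hH'.
  apply: (@no_twin_holes T e e_sym e_irr u u' t H H') => //.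
  - by rewrite /eNC -aE; apply: ncC.
  - by rewrite /eNC -aE; apply: ncC.
  - by apply/adjP; apply: adjK => //; [apply/nesym | rewrite uC u'C].
  - by apply/negP => /adjP.
  - by apply/negP => /adjP.
  - exact/nesym.
  - exact/nesym.
have wC := notC _ _ uC buw; have w'C := notC _ _ u'C bu'w'.
have [uK wK uw nuw] := buw; have [u'K w'K u'w' nu'w'] := bu'w'.
have u'w : u' <> w by move=> h; rewrite -h u'C in wC.
have uw' : u <> w' by move=> h; rewrite -h uC in w'C.
have ww' : w <> w' by move=> h; apply: (same w) => //; rewrite h.
have a1 : e u u' by apply/adjP; apply: adjK => //; [apply/nesym | rewrite uC u'C].
have a2 : e w w' by apply/adjP; apply: adjK => //; rewrite (negbTE wC) (negbTE w'C).
(* A missing cross edge would make [w] a common non-neighbour of [u] and [u'], excluded by [same].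
   With all four edges present, [u u' w w'] is an induced 4-cycle. *)
have a3 : e u' w by apply/adjP; apply: contrapT => h; apply: (same w).
have a4 : e u w' by apply/adjP; apply: contrapT => h; apply: (same w').
pose P z := [\/ z = u', z = w | z = w'].
have [|||||||X [hX uX u'X _ _]] := @hole_centered T e e_sym e_irr u u' w' P => //.
- apply: (conn_step a3); [by constructor 1 | by constructor 2 |].
  by apply: (conn_edge a2); [constructor 2 | constructor 3].
- by apply/negP => /adjP.
- by case=> // h; apply: u'u.
- by move=> z [->|->|->]; auto => /adjP.
exact: nocom hX uX u'X.
Qed.
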